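(* Let $\rho$ be a non-degenerate probability distribution on $U\times V$. Let $1\le p\le q\le\infty$, and let $q'$ and $c$ be defined by $1/q+1/q'=1$ and $1/c=1/p+1/q'$. If $\rho$ is $q$-to-$p$ hypercontractive, then for every $z\in[0,1]$, $$\mathrm{agr}_\rho(z)\ \ge\ \frac{\bigl(p^{1/p}\,(q')^{1/q'}\,z\bigr)^c}{c},$$ and in particular $\mathrm{col}_\rho(n)=\Omega(n^{1-c})$ as $n\to\infty$, where the implied constant does not depend on $n$. (Convention: $1/\infty=0$ and $\infty^{1/\infty}=1$.)
   Context: $U,V$ are finite sets. $\rho$ is degenerate if its marginal $\rho_U$ on $U$ or its marginal $\rho_V$ on $V$ is a point mass, and non-degenerate otherwise. Hypercontractivity. For a probability distribution $\mu$ on $X$ and $f\colon X\to\mathbb{C}$, $\|f\|_{L_p(\mu)}=(\mathbf{E}_{x\sim\mu}|f(x)|^p)^{1/p}$ for $1\le p<\infty$ and $\|f\|_{L_\infty(\mu)}=\max_{x:\mu(x)>0}|f(x)|$. For $f\colon U\to\mathbb{C}$ define $(T_\rho f)(v)=\sum_{u\in U}\frac{\rho(u,v)}{\rho_V(v)}f(u)$ (for $v$ in the support of $\rho_V$). $\rho$ is $q$-to-$p$ hypercontractive if $\|T_\rho f\|_{L_q(\rho_V)}\le\|f\|_{L_p(\rho_U)}$ for all $f\colon U\to\mathbb{C}$. Agreement complexity. An agreement protocol for $\rho$ consists of $\ell\in\mathbb{N}$ and functions $f\colon U^\ell\to[0,1]$, $g\colon V^\ell\to[0,1]$. Its cost is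 $\mathbf{E}[f(\vec u)+g(\vec v)]$ and its success probability is $\mathbf{E}[f(\vec u)g(\vec v)]$, where $(\vec u,\vec v)\sim\rho^{\otimes\ell}$. $\mathrm{agr}_\rho(z)$ is the infimum of the cost over all agreement protocols for $\rho$ with success probability at least $z$. Collision complexity. A $p$-collision protocol for $\rho$ with domain size $n$ consists of $\ell\in\mathbb{N}$ and maps $A\colon U^\ell\to\mathcal P([n])$, $B\colon V^\ell\to\mathcal P([n])$ (possibly randomised using private independent randomness) such that $\Pr_{(\vec u,\vec v)\sim\rho^{\otimes\ell}}[i\in A(\vec u)\cap B(\vec v)]\ge p$ for every $i\in[n]$. Its output size is the maximum possible value of $\max\{|A(\vec u)|,|B(\vec v)|\}$. $\mathrm{col}_\rho(n,p)$ is the infimum of the output size over all $p$-collision protocols for $\rho$ with domain size $n$, and $\mathrm{col}_\rho(n)=\mathrm{col}_\rho(n,1/n)$. *)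

(* Defs.v *)
From HB Require Import structures.
From mathcomp Require Import all_boot all_order all_algebra.
From mathcomp Require Import all_classical all_reals all_analysis.
From mathcomp Require Import complex.
Set Implicit Arguments.
Unset Strict Implicit.
Unset Printing Implicit Defensive.
Import Order.TTheory GRing.Theory Num.Theory.
Import numFieldNormedType.Exports.
Local Open Scope classical_set_scope.
Local Open Scope ring_scope.
Local Open Scope complex_scope.

Definition is_distribution (R : realType) (X : finType) (mu : X -> R) : Prop :=
  (forall x, 0 <= mu x) /\ \sum_x mu x = 1.

Definition point_mass (R : realType) (X : finType) (mu : X -> R) : Prop :=
  exists x, mu x = 1.

Section Distributions.
Variables (R : realType) (U V : finType) (rho : U * V -> R).

Definition marginalU (u : U) : R := \sum_v rho (u, v).
Definition marginalV (v : V) : R := \sum_u rho (u, v).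

Definition degenerate : Prop := point_mass marginalU \/ point_mass marginalV.

Definition tensor (l : nat) (u : {ffun 'I_l -> U}) (v : {ffun 'I_l -> V}) : R :=
  \prod_(i < l) rho (u i, v i).

End Distributions.

Section Hypercontractivity.
Variable R : realType.

(* p ranges over [1, +oo]; the value at -oo is junk. *)
Definition Lp_norm (X : finType) (mu : X -> R) (p : \bar R) (f : X -> R[i]) : R :=
  match p with
  | r%:E => (\sum_x mu x * Normc.normc (f x) `^ r) `^ r^-1
  | +oo%E => \big[Num.max/0]_(x | 0 < mu x) Normc.normc (f x)
  | -oo%E => 0
  end.

Variables (U V : finType) (rho : U * V -> R).

(* Outside the support of the V-marginal the quotient is 0, as x / 0 = 0;
   those points do not contribute to any norm. *)
Definition T_op (f : U -> R[i]) (v : V) : R[i] :=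
  \sum_u (rho (u, v) / marginalV rho v)%:C * f u.

Definition hypercontractive (q p : \bar R) : Prop :=
  forall f : U -> R[i],
    Lp_norm (marginalV rho) q (T_op f) <= Lp_norm (marginalU rho) p f.

End Hypercontractivity.

Section Agreement.
Variables (R : realType) (U V : finType) (rho : U * V -> R).

Record agr_protocol := AgrProtocol {
  agr_len : nat;
  agr_f : {ffun 'I_agr_len -> U} -> R;
  agr_g : {ffun 'I_agr_len -> V} -> R;
  agr_f01 : forall u, 0 <= agr_f u <= 1;
  agr_g01 : forall v, 0 <= agr_g v <= 1 }.

Definition agr_cost (P : agr_protocol) : R :=
  \sum_u \sum_v tensor rho u v * (@agr_f P u + @agr_g P v).

Definition agr_success (P : agr_protocol) : R :=
  \sum_u \sum_v tensor rho u v * (@agr_f P u * @agr_g P v).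

Definition agreement_complexity (z : R) : \bar R :=
  ereal_inf [set (agr_cost P)%:E | P in [set P | z <= agr_success P]].

End Agreement.

Section Collision.
Variables (R : realType) (U V : finType) (rho : U * V -> R).

(* A map to subsets of [n] randomised with private independent randomness is
   given by its output laws: col_A u S is the probability that A(u) = S, and
   given (u, v) the sets A(u) and B(v) are independent. Deterministic maps are
   the case where every law is a point mass. *)
Record col_protocol (n : nat) := ColProtocol {
  col_len : nat;
  col_A : {ffun 'I_col_len -> U} -> {set 'I_n} -> R;
  col_B : {ffun 'I_col_len -> V} -> {set 'I_n} -> R;
  col_A_dist : forall u, is_distribution (col_A u);
  col_B_dist : forall v, is_distribution (col_B v) }.

Definition col_joint n (P : col_protocol n) (u : {ffun 'I_(col_len P) -> U})
    (v : {ffun 'I_(col_len P) -> V}) (S T : {set 'I_n}) : R :=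
  tensor rho u v * @col_A n P u S * @col_B n P v T.

Definition is_collision n (p : R) (P : col_protocol n) : Prop :=
  forall i : 'I_n,
    p <= \sum_u \sum_v \sum_S \sum_(T | i \in S :&: T) @col_joint n P u v S T.

(* The maximum runs over the outcomes of positive probability. *)
Definition output_size n (P : col_protocol n) : nat :=
  \max_u \max_v \max_S \max_(T | (0 < @col_joint n P u v S T)%R)
    maxn #|S| #|T|.

Definition collision_complexity_at (n : nat) (p : R) : \bar R :=
  ereal_inf [set (output_size P)%:R%:E |
    P in [set P : col_protocol n | is_collision p P]].

Definition collision_complexity (n : nat) : \bar R := 
  collision_complexity_at n n%:R^-1.

End Collision.

(* p^(1/p), with oo^(1/oo) = 1. *)
Definition self_root (R : realType) (p : \bar R) : R :=
  if p is r%:E then r `^ r^-1 else 1.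

(* Main.v *)
(** By Hoelder, [q]-to-[p] hypercontractivity gives the two-function inequality
    E[f(u) g(v)] <= ||f||_p ||g||_q'. In this form it tensorizes by a direct
    induction on the number of coordinates: condition on the first coordinate,
    bound the inner expectation by the product of the norms of the sections, and
    apply the one-coordinate inequality to these norms. For f, g with values in
    [0,1] we have ||f||_p <= E[f]^(1/p), so the success probability of a protocol
    is at most E[f]^(1/p) E[g]^(1/q'), and the weighted AM-GM inequality bounds
    this by the cost E[f] + E[g].

    A collision protocol for [n] yields, for each i, the agreement protocol
    f_i(u) = Pr[i in A(u)], g_i(v) = Pr[i in B(v)]. The costs of these n protocols
    sum to E|A| + E|B|, which is at most twice the output size. *)

Require Import Defs.
From HB Require Import structures.
From mathcomp Require Import all_boot all_order all_algebra.
From mathcomp Require Import all_classical all_reals all_analysis.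
From mathcomp Require Import complex.
From mathcomp Require Import ring.
Set Implicit Arguments.
Unset Strict Implicit.
Unset Printing Implicit Defensive.
Import Order.TTheory GRing.Theory Num.Theory.
Import numFieldNormedType.Exports.
Local Open Scope classical_set_scope.
Local Open Scope ring_scope.

(** * Real inequalities: weighted AM-GM and Hoelder for finite sums *)

(** Young's inequality with the conjugate exponents [a / c] and [b / c], applied to [(a * x)]^ (c /
    a)[and](b * y) [^ (c / b)]: the two resulting terms are [c * x] and [c * y]. This choice
    produces the constants [a]^ a^-1[and]b [^ b^-1]. *)
Lemma powR_amgm (R : realType) (a b c x y : R) :
  0 < a -> 0 < b -> 0 < c -> c^-1 = a^-1 + b^-1 -> 0 <= x -> 0 <= y ->
  (a `^ a^-1 * b `^ b^-1 * (x `^ a^-1 * y `^ b^-1)) `^ c / c <= x + y.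
Proof.
move=> a0 b0 c0 cE x0 y0; have [/ltW a0' /ltW b0'] := (a0, b0).
rewrite mulrACA -!powRM // (@powRM _ (_ `^ _)) ?powR_ge0 // -!powRrM.
rewrite ler_pdivrMr //.
have conj : (a / c)^-1 + (b / c)^-1 = 1.
  by rewrite !invf_div -mulrDr -cE mulfV ?lt0r_neq0.
have := @conjugate_powR R ((a * x) `^ (a^-1 * c)) ((b * y) `^ (b^-1 * c)) _ _
  (powR_ge0 _ _) (powR_ge0 _ _) (divr_gt0 a0 c0) (divr_gt0 b0 c0) conj.
have cancel (d : R) : 0 < d -> d^-1 * c * (d / c) = 1.
  by move=> d0; field; rewrite !lt0r_neq0.
rewrite -!powRrM !cancel // !powRr1 ?mulr_ge0 //.
move=> /le_trans; apply; rewrite le_eqVlt; apply/orP; left; apply/eqP.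
by field; rewrite !lt0r_neq0.
Qed.

(** Induction on the sequence: each step is the two-term inequality [hoelder2], with the norms of
    the two tails as second entries. *)
Lemma hoelder_sum (R : realType) (I : Type) (r : seq I) (f g : I -> R) (s t : R) :
  0 < s -> 0 < t -> s^-1 + t^-1 = 1 ->
  (forall i, 0 <= f i) -> (forall i, 0 <= g i) ->
  \sum_(i <- r) f i * g i <=
  (\sum_(i <- r) f i `^ s) `^ s^-1 * (\sum_(i <- r) g i `^ t) `^ t^-1.
Proof.
move=> s0 t0 st f0 g0; elim: r => [|i r IH].
  by rewrite big_nil mulr_ge0 ?powR_ge0.
rewrite !big_cons.
have sums (h : I -> R) (d : R) : 0 < d -> (\sum_(j <- r) h j `^ d) =
    ((\sum_(j <- r) h j `^ d) `^ d^-1) `^ d.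
  move=> d0; rewrite -powRrM mulVf ?lt0r_neq0 // powRr1 //.
  by rewrite sumr_ge0 // => j _; rewrite powR_ge0.
apply: le_trans (lerD (lexx _) IH) _.
rewrite [X in _ <= (_ + X) `^ _ * _]sums // [X in _ <= _ * (_ + X) `^ _]sums //.
by apply: hoelder2 => //; rewrite powR_ge0.
Qed.

(** * The two-function form of hypercontractivity *)

Lemma marginalU_ge0 (R : realType) (U V : finType) (rho : U * V -> R) :
  is_distribution rho -> forall u, 0 <= marginalU rho u.
Proof. by move=> [rho0 _] u; rewrite sumr_ge0. Qed.

Lemma marginalV_ge0 (R : realType) (U V : finType) (rho : U * V -> R) :
  is_distribution rho -> forall v, 0 <= marginalV rho v.
Proof. by move=> [rho0 _] v; rewrite sumr_ge0. Qed.

(** The weights are arbitrary, so that [rho] with its marginals and the tensor powers with product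
    weights are both instances. *)
Definition bilinear_hypercontractive (R : realType) (U V : finType)
    (w : U -> V -> R) (wU : U -> R) (wV : V -> R) (a b : R) : Prop :=
  forall (f : U -> R) (g : V -> R),
    (forall u, 0 <= f u) -> (forall v, 0 <= g v) ->
    \sum_u \sum_v w u v * (f u * g v) <=
    (\sum_u wU u * f u `^ a) `^ a^-1 * (\sum_v wV v * g v `^ b) `^ b^-1.

Lemma marginalV_eq0 (R : realType) (U V : finType) (rho : U * V -> R) u v :
  is_distribution rho -> marginalV rho v = 0 -> rho (u, v) = 0.
Proof.
move=> [rho0 _] /eqP; rewrite psumr_eq0 => [/allP /(_ u (mem_index_enum _)) /eqP->//|u1 _] //.
Qed.

Lemma normc_real (R : realType) (x : R) : 0 <= x -> Normc.normc x%:C%C = x.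
Proof. by move=> x0; rewrite /= expr0n addr0 sqrtr_sqr ger0_norm. Qed.

Lemma T_op_real (R : realType) (U V : finType) (rho : U * V -> R) (f : U -> R) v :
  T_op rho (fun u => (f u)%:C%C) v =
  (\sum_u rho (u, v) / marginalV rho v * f u)%:C%C.
Proof. by rewrite rmorph_sum; apply: eq_bigr => u _; rewrite [RHS]rmorphM. Qed.

(** Conditioning on [v] turns the pairing of [f] and [g] into that of [T f] and [g]. Where the
    marginal vanishes, so does the whole column of [rho], and the junk quotient is harmless. *)
Lemma bilinear_T_op (R : realType) (U V : finType) (rho : U * V -> R)
    (f : U -> R) (g : V -> R) : is_distribution rho ->
  \sum_u \sum_v rho (u, v) * (f u * g v) =
  \sum_v marginalV rho v * ((\sum_u rho (u, v) / marginalV rho v * f u) * g v).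
Proof.
move=> rhoD; rewrite exchange_big; apply: eq_bigr => v _.
rewrite mulr_suml mulr_sumr; apply: eq_bigr => u _.
have [m0|m0] := eqVneq (marginalV rho v) 0; last by field.
by rewrite (marginalV_eq0 u rhoD m0) m0 !mul0r.
Qed.

Lemma bilinear_of_hypercontractive (R : realType) (U V : finType)
    (rho : U * V -> R) (a b : R) (q : \bar R) :
  is_distribution rho -> 0 < b -> (0 < q)%E -> (q^-1 + b%:E^-1 = 1)%E ->
  hypercontractive rho q a%:E ->
  bilinear_hypercontractive (fun u v => rho (u, v)) (marginalU rho) (marginalV rho) a b.
Proof.
move=> rhoD b0 q0 qb hyp f g f0 g0.
have V0 := marginalV_ge0 rhoD.
pose Tf v := \sum_u rho (u, v) / marginalV rho v * f u.
have Tf0 v : 0 <= Tf v.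
  by rewrite sumr_ge0 // => u _; rewrite mulr_ge0 // divr_ge0 // rhoD.1.
rewrite bilinear_T_op // -/(Tf _).
have := hyp (fun u => (f u)%:C%C).
rewrite [X in _ <= X](_ : _ = (\sum_u marginalU rho u * f u `^ a) `^ a^-1); last first.
  by congr (_ `^ _); apply: eq_bigr => u _; rewrite normc_real.
move=> hypf.
apply: le_trans (ler_wpM2r (powR_ge0 _ _) hypf).
have normT v : Normc.normc (T_op rho (fun u => (f u)%:C%C) v) = Tf v.
  by rewrite T_op_real normc_real; [|exact: Tf0].
case: q q0 qb {hyp hypf} => [s| |] //.
- rewrite lte_fin => s0.
  rewrite !inver !gt_eqF // -EFinD => -[sb].
  have powsum (h : V -> R) (d : R) : 0 < d -> (forall v, 0 <= h v) ->
      \sum_v marginalV rho v * h v `^ d = \sum_v (marginalV rho v `^ d^-1 * h v) `^ d.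
    move=> d0 h0; apply: eq_bigr => v _.
    by rewrite powRM ?powR_ge0 // -powRrM mulVf ?lt0r_neq0 // powRr1.
  under [X in X `^ _ * _]eq_bigr do rewrite normT.
  rewrite !powsum //; apply: (le_trans _ (hoelder_sum _ s0 b0 sb _ _)); last 2 first.
  - by move=> v; rewrite mulr_ge0 ?powR_ge0.
  - by move=> v; rewrite mulr_ge0 ?powR_ge0.
  apply: ler_sum => v _; rewrite mulrACA -powRD; last by rewrite sb oner_eq0.
  by rewrite sb powRr1.
(* For infinite [q] the dual exponent [b] is 1, and [Tf] is bounded by its maximum over the support;
   points of mass zero contribute nothing. *)
- move=> _; rewrite invey add0e => /eqP; rewrite inve_eq1 => /eqP[->].
  rewrite invr1 powRr1; last first.
    by rewrite sumr_ge0 // => v _; rewrite mulr_ge0 ?powR_ge0.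
  rewrite /Lp_norm mulr_sumr; apply: ler_sum => v _; rewrite powRr1 //.
  have := V0 v; rewrite le_eqVlt => /predU1P[<-|v0]; first by rewrite !mul0r mulr0.
  rewrite [X in X <= _]mulrCA ler_wpM2r ?mulr_ge0 ?(ltW v0) // -/(Tf v) -normT.
  exact: (@le_bigmax_cond _ _ _ 0 v _ (fun v => Normc.normc (T_op rho _ v))).
Qed.

(** * Tensorization *)

Definition ffun_cons (T : Type) l (x : T) (t : {ffun 'I_l -> T}) : {ffun 'I_l.+1 -> T} :=
  [ffun i => if unlift ord0 i is Some j then t j else x].

Lemma ffun_cons0 (T : Type) l (x : T) (t : {ffun 'I_l -> T}) : ffun_cons x t ord0 = x.
Proof. by rewrite ffunE unlift_none. Qed.

Lemma ffun_cons_lift (T : Type) l (x : T) (t : {ffun 'I_l -> T}) i :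
  ffun_cons x t (lift ord0 i) = t i.
Proof. by rewrite ffunE liftK. Qed.

Lemma sum_ffun_cons (R : realType) (T : finType) l (F : {ffun 'I_l.+1 -> T} -> R) :
  \sum_t F t = \sum_x \sum_t F (ffun_cons x t).
Proof.
rewrite pair_big (reindex (fun xt => ffun_cons xt.1 xt.2)) //=.
exists (fun t => (t ord0, [ffun i => t (lift ord0 i)])) => [[x t] _|t _] /=.
  by rewrite ffun_cons0; congr pair; apply/ffunP => i; rewrite ffunE ffun_cons_lift.
by apply/ffunP => i; rewrite ffunE; case: unliftP => [j|] -> //; rewrite ffunE.
Qed.

Lemma tensor_cons (R : realType) (U V : finType) (rho : U * V -> R) l x y
    (u : {ffun 'I_l -> U}) (v : {ffun 'I_l -> V}) :
  tensor rho (ffun_cons x u) (ffun_cons y v) = rho (x, y) * tensor rho u v.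
Proof.
rewrite /tensor big_ord_recl !ffun_cons0; congr (_ * _).
by apply: eq_bigr => i _; rewrite !ffun_cons_lift.
Qed.

Lemma prod_cons (R : realType) (U : finType) (w : U -> R) l x (u : {ffun 'I_l -> U}) :
  \prod_i w (ffun_cons x u i) = w x * \prod_i w (u i).
Proof.
rewrite big_ord_recl !ffun_cons0; congr (_ * _).
by apply: eq_bigr => i _; rewrite !ffun_cons_lift.
Qed.

Lemma sum_ffun0 (R : realType) (T : finType) (F : {ffun 'I_0 -> T} -> R) t :
  \sum_u F u = F t.
Proof.
by rewrite (big_pred1 t) // => u; apply/esym/eqP/ffunP => -[].
Qed.

Lemma bilinear_tensor (R : realType) (U V : finType) (rho : U * V -> R)
    (wU : U -> R) (wV : V -> R) (a b : R) l :
  (forall uv, 0 <= rho uv) -> (forall u, 0 <= wU u) -> (forall v, 0 <= wV v) ->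
  0 < a -> 0 < b ->
  bilinear_hypercontractive (fun u v => rho (u, v)) wU wV a b ->
  @bilinear_hypercontractive R {ffun 'I_l -> U} {ffun 'I_l -> V} (@tensor R U V rho l)
    (fun u => \prod_i wU (u i)) (fun v => \prod_i wV (v i)) a b.
Proof.
move=> rho0 wU0 wV0 a0 b0 bh; elim: l => [|l IH] f g f0 g0.
  (* In length 0 there is a single point on each side and all products are empty, so both sides
     equal the product of the two values. *)
  have u0 : {ffun 'I_0 -> U} by apply: finfun => -[].
  have v0 : {ffun 'I_0 -> V} by apply: finfun => -[].
  rewrite !(sum_ffun0 _ u0) !(sum_ffun0 _ v0) /tensor !big_ord0 !mul1r.
  by rewrite -!powRrM !mulfV ?lt0r_neq0 // !powRr1.
(* [F] and [G] are the norms of the sections of [f] and [g] with the first coordinate fixed. *)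
pose F u := (\sum_(u' : {ffun 'I_l -> U}) (\prod_i wU (u' i)) * f (ffun_cons u u') `^ a) `^ a^-1.
pose G v := (\sum_(v' : {ffun 'I_l -> V}) (\prod_i wV (v' i)) * g (ffun_cons v v') `^ b) `^ b^-1.
(* Fubini for norms: taking the norm of the section norms gives back the full norm, so the target
   bound is the one-coordinate inequality for [F] and [G]. *)
have norm_cons (T : finType) (w : T -> R) (h : {ffun 'I_l.+1 -> T} -> R) d :
    (forall x, 0 <= w x) -> 0 < d -> \sum_(t : {ffun 'I_l.+1 -> T}) (\prod_i w (t i)) * h t `^ d =
    \sum_x w x * ((\sum_(t : {ffun 'I_l -> T}) (\prod_i w (t i)) * h (ffun_cons x t) `^ d) `^ d^-1) `^ d.
  move=> w0 d0; rewrite sum_ffun_cons; apply: eq_bigr => x _.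
  rewrite -powRrM mulVf ?lt0r_neq0 // powRr1; last first.
    by rewrite sumr_ge0 // => t _; rewrite mulr_ge0 ?powR_ge0 ?prodr_ge0.
  by rewrite mulr_sumr; apply: eq_bigr => t _; rewrite prod_cons mulrA.
rewrite !norm_cons //; apply: (le_trans _ (bh F G _ _)); last 2 first.
- by move=> u; exact: powR_ge0.
- by move=> v; exact: powR_ge0.
rewrite sum_ffun_cons; apply: ler_sum => u _.
under eq_bigr do rewrite sum_ffun_cons.
rewrite exchange_big; apply: ler_sum => v _.
under eq_bigr do under eq_bigr do rewrite tensor_cons -mulrA.
under eq_bigr do rewrite -mulr_sumr.
rewrite -mulr_sumr ler_wpM2l //.
by apply: (IH (fun t => f (ffun_cons u t)) (fun t => g (ffun_cons v t))).
Qed.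

(** * Lower bound on the cost of agreement protocols *)

Lemma tensor_ge0 (R : realType) (U V : finType) (rho : U * V -> R) l
    (u : {ffun 'I_l -> U}) (v : {ffun 'I_l -> V}) :
  (forall uv, 0 <= rho uv) -> 0 <= tensor rho u v.
Proof. by move=> rho0; rewrite prodr_ge0. Qed.

Lemma sum_tensorV (R : realType) (U V : finType) (rho : U * V -> R) l
    (u : {ffun 'I_l -> U}) :
  \sum_v tensor rho u v = \prod_i marginalU rho (u i).
Proof. by rewrite /marginalU bigA_distr_bigA. Qed.

Lemma sum_tensorU (R : realType) (U V : finType) (rho : U * V -> R) l
    (v : {ffun 'I_l -> V}) :
  \sum_u tensor rho u v = \prod_i marginalV rho (v i).
Proof. by rewrite /marginalV bigA_distr_bigA. Qed.

Lemma sum_tensor (R : realType) (U V : finType) (rho : U * V -> R) l :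
  is_distribution rho ->
  \sum_(u : {ffun 'I_l -> U}) \sum_(v : {ffun 'I_l -> V}) tensor rho u v = 1.
Proof.
move=> [_ rho1]; under eq_bigr do rewrite sum_tensorV.
rewrite -(bigA_distr_bigA (fun (_ : 'I_l) u => marginalU rho u)) big1 // => i _.
by rewrite /marginalU pair_big -[RHS]rho1; apply: eq_bigr => -[].
Qed.

Lemma agr_costE (R : realType) (U V : finType) (rho : U * V -> R)
    (P : agr_protocol R U V) :
  agr_cost rho P =
  \sum_(u : {ffun 'I_(agr_len P) -> U}) (\prod_i marginalU rho (u i)) * @agr_f _ _ _ P u +
  \sum_(v : {ffun 'I_(agr_len P) -> V}) (\prod_i marginalV rho (v i)) * @agr_g _ _ _ P v.
Proof.
rewrite /agr_cost.
under eq_bigr do under eq_bigr do rewrite mulrDr.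
under eq_bigr do rewrite big_split.
rewrite big_split /= [X in _ + X]exchange_big; congr (_ + _).
  by apply: eq_bigr => u _; rewrite -mulr_suml sum_tensorV.
by apply: eq_bigr => v _; rewrite -mulr_suml sum_tensorU.
Qed.

(** On the unit interval, raising to a power [d] with [1 <= d] does not increase a value. *)
Lemma norm_unit_interval (R : realType) (T : finType) (w h : T -> R) d :
  (forall x, 0 <= w x) -> (forall x, 0 <= h x <= 1) -> 1 <= d ->
  (\sum_x w x * h x `^ d) `^ d^-1 <= (\sum_x w x * h x) `^ d^-1.
Proof.
move=> w0 h01 d1; have d0 : 0 < d by exact: lt_le_trans d1.
have h0 x : 0 <= h x by have /andP[] := h01 x.
apply: ge0_ler_powR; rewrite ?invr_ge0 ?nnegrE ?sumr_ge0 ?(ltW d0) //.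
- by move=> x _; rewrite mulr_ge0 ?powR_ge0.
- by move=> x _; rewrite mulr_ge0.
apply: ler_sum => x _; rewrite ler_wpM2l //.
have := h0 x; rewrite le_eqVlt => /predU1P[<-|hx]; first by rewrite powR0 ?lt0r_neq0.
by apply: ge1r_powR => //; rewrite hx; have /andP[] := h01 x.
Qed.

(** Pointwise, [f * g <= g <= f + g] for values in the unit interval. *)
Lemma agr_success_le_cost (R : realType) (U V : finType) (rho : U * V -> R)
    (P : agr_protocol R U V) :
  is_distribution rho -> agr_success rho P <= agr_cost rho P.
Proof.
move=> [rho0 _]; apply: ler_sum => u _; apply: ler_sum => v _.
rewrite ler_wpM2l ?tensor_ge0 //.
have /andP[f0 f1] := agr_f01 u; have /andP[g0 _] := agr_g01 v.
apply: le_trans (ler_piMl g0 f1) _; by rewrite lerDr.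
Qed.

Lemma agr_cost_bound (R : realType) (U V : finType) (rho : U * V -> R)
    (a b c z : R) (P : agr_protocol R U V) :
  is_distribution rho -> 1 <= a -> 1 <= b -> 0 < c -> c^-1 = a^-1 + b^-1 ->
  bilinear_hypercontractive (fun u v => rho (u, v)) (marginalU rho) (marginalV rho) a b ->
  0 <= z <= agr_success rho P ->
  (a `^ a^-1 * b `^ b^-1 * z) `^ c / c <= agr_cost rho P.
Proof.
move=> rhoD a1 b1 c0 cE bh /andP[z0 zP].
have a0 : 0 < a by exact: lt_le_trans a1.
have b0 : 0 < b by exact: lt_le_trans b1.
have wU0 (u : {ffun 'I_(agr_len P) -> U}) : 0 <= \prod_i marginalU rho (u i).
  by rewrite prodr_ge0 // => i _; exact: marginalU_ge0.
have wV0 (v : {ffun 'I_(agr_len P) -> V}) : 0 <= \prod_i marginalV rho (v i).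
  by rewrite prodr_ge0 // => i _; exact: marginalV_ge0.
have f01 := @agr_f01 _ _ _ P; have g01 := @agr_g01 _ _ _ P.
have f0 u : 0 <= @agr_f _ _ _ P u by have /andP[] := f01 u.
have g0 v : 0 <= @agr_g _ _ _ P v by have /andP[] := g01 v.
rewrite agr_costE.
(* AM-GM is used with the two expectations as [x] and [y]; it remains to bound [z] by the product of
   their powers. *)
apply: (le_trans _ (powR_amgm a0 b0 c0 cE _ _)); last 2 first.
- by rewrite sumr_ge0 // => u _; rewrite mulr_ge0.
- by rewrite sumr_ge0 // => v _; rewrite mulr_ge0.
rewrite ler_pM2r ?invr_gt0 //.
apply: ge0_ler_powR; rewrite ?(ltW c0) ?nnegrE ?mulr_ge0 ?powR_ge0 //.
rewrite ler_wpM2l ?mulr_ge0 ?powR_ge0 //; apply: (le_trans zP).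
apply: (le_trans (bilinear_tensor _ _ _ _ _ bh f0 g0)) => //.
- exact: rhoD.1.
- exact: marginalU_ge0.
- exact: marginalV_ge0.
by apply: ler_pM; rewrite ?powR_ge0 ?norm_unit_interval.
Qed.

(* When [p] or [q'] is infinite, the first alternative holds, and the bound on
   the agreement complexity reduces to success <= cost. *)
Lemma exponent_cases (R : realType) (p q q' : \bar R) (c : R) :
  (1 <= p)%E -> (p <= q)%E ->
  (q^-1 + q'^-1 = 1)%E -> (c%:E^-1 = p^-1 + q'^-1)%E ->
  (c = 1 /\ self_root p * self_root q' = 1) \/
  exists a b : R, [/\ p = a%:E, q' = b%:E, 1 <= a, 1 <= b & 0 < c /\ c^-1 = a^-1 + b^-1].
Proof.
move=> p1 pq; have q1 : (1 <= q)%E by exact: le_trans pq.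
case: q' => [b| |].
(* In the extended reals the inverse of 0 is [+oo], which would make the sum with [q^-1] infinite
   rather than 1. *)
- have [->|b_neq0] := eqVneq b 0.
    rewrite inve0 addey => [//|].
    by rewrite gt_eqF // (lt_le_trans ltNy0) // inve_ge0 (le_trans lee01 q1).
  rewrite [b%:E^-1%E]inver (negbTE b_neq0).
  case: q q1 pq => [s| |] // q1 pq.
    have s1 : 1 <= s by rewrite lee_fin in q1.
    have s0 : 0 < s by exact: lt_le_trans s1.
    rewrite inver gt_eqF // -EFinD => -[sb].
    case: p p1 pq => [a| |] // p1 pq.
    have a1 : 1 <= a by rewrite lee_fin in p1.
    have a0 : 0 < a by exact: lt_le_trans a1.
    have ib0 : 0 <= b^-1.
      by rewrite -(addKr s^-1 b^-1) sb addrC subr_ge0 invf_le1.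
    have b0 : 0 < b by rewrite lt_neqAle eq_sym b_neq0 -invr_ge0.
    have b1 : 1 <= b by rewrite -invf_le1 // -sb lerDr invr_ge0 ltW.
    rewrite !inver (gt_eqF a0) -EFinD; case: eqVneq => // c_neq0 [cE].
    right; exists a, b; split=> //; split=> //.
    by rewrite -invr_gt0 cE addr_gt0 ?invr_gt0.
  (* Here [q] is infinite, which forces [b = 1]; a finite [p] gives the second alternative, and an
     infinite [p] gives [c = 1]. *)
  rewrite invey add0e => -[] /(congr1 GRing.inv); rewrite invrK invr1 => ->.
  case: p p1 {pq} => [a| |] // p1.
    have a1 : 1 <= a by rewrite lee_fin in p1.
    have a0 : 0 < a by exact: lt_le_trans a1.
    rewrite !inver (gt_eqF a0) -EFinD; case: eqVneq => // c_neq0 [cE].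
    right; exists a, 1; split=> //; split=> //.
    by rewrite -invr_gt0 cE addr_gt0 ?invr_gt0.
  rewrite invey add0e !inver invr1; case: eqVneq => // _ [] /(congr1 GRing.inv).
  by rewrite invrK invr1 => ->; left; rewrite /= powR1 mulr1.
(* Infinite [q'] forces [q = 1], hence [p = 1] and [c = 1]. *)
- rewrite invey adde0 => /eqP; rewrite inve_eq1 => /eqP q1E.
  have -> : p = 1%E by apply/le_anti; rewrite p1 -q1E pq.
  rewrite adde0 inve1 => /eqP; rewrite inve_eq1 => /eqP[->].
  by left; rewrite /= powR1 mulr1.
- by rewrite inveNy addeNy.
Qed.

Lemma agreement_lower_bound (R : realType) (U V : finType) (rho : U * V -> R)
    (p q q' : \bar R) (c z : R) (P : agr_protocol R U V) :
  is_distribution rho -> (1 <= p)%E -> (p <= q)%E ->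
  (q^-1 + q'^-1 = 1)%E -> (c%:E^-1 = p^-1 + q'^-1)%E ->
  hypercontractive rho q p -> 0 <= z <= agr_success rho P ->
  (self_root p * self_root q' * z) `^ c / c <= agr_cost rho P.
Proof.
move=> rhoD p1 pq q'E cE hyp zP; have /andP[z0 zs] := zP.
have [[-> ->]|[a [b [pa qb a1 b1 [c0 abc]]]]] := exponent_cases p1 pq q'E cE.
  rewrite mul1r powRr1 // divr1; apply: le_trans zs _; exact: agr_success_le_cost.
move: p1 pq q'E cE hyp; rewrite pa qb => p1 pq q'E cE hyp.
apply: agr_cost_bound => //; apply: bilinear_of_hypercontractive q'E hyp => //.
  exact: lt_le_trans b1.
by apply: lt_le_trans pq; apply: lt_le_trans p1.
Qed.

Lemma exponent_facts (R : realType) (p q q' : \bar R) (c : R) :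
  (1 <= p)%E -> (p <= q)%E ->
  (q^-1 + q'^-1 = 1)%E -> (c%:E^-1 = p^-1 + q'^-1)%E ->
  0 < c /\ 0 < self_root p * self_root q'.
Proof.
move=> p1 pq q'E cE.
have [[-> ->]|[a [b [-> -> a1 b1 [c0 _]]]]] := exponent_cases p1 pq q'E cE.
  by rewrite ltr01.
by split=> //; rewrite mulr_gt0 ?powR_gt0 // (lt_le_trans ltr01).
Qed.

(** * From collision protocols to agreement protocols *)

Definition membership_prob (R : realType) n (D : {set 'I_n} -> R) (i : 'I_n) : R :=
  \sum_(S : {set 'I_n} | i \in S) D S.

Lemma membership_prob01 (R : realType) n (D : {set 'I_n} -> R) i :
  is_distribution D -> 0 <= membership_prob D i <= 1.
Proof.
move=> [D0 D1]; rewrite sumr_ge0 //= -D1.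
by rewrite [leRHS](bigID (fun S : {set 'I_n} => i \in S)) /= lerDl sumr_ge0.
Qed.

Lemma sum_membership_prob (R : realType) n (D : {set 'I_n} -> R) :
  \sum_i membership_prob D i = \sum_S D S * #|S|%:R.
Proof.
rewrite /membership_prob (exchange_big_dep predT) //=; apply: eq_bigr => S _.
by rewrite sumr_const mulr_natr.
Qed.

Definition membership_protocol (R : realType) (U V : finType) n
    (P : col_protocol R U V n) (i : 'I_n) : agr_protocol R U V :=
  @AgrProtocol R U V (col_len P)
    (fun u => membership_prob (@col_A _ _ _ _ P u) i)
    (fun v => membership_prob (@col_B _ _ _ _ P v) i)
    (fun u => membership_prob01 i (col_A_dist u))
    (fun v => membership_prob01 i (col_B_dist v)).

(** Private randomness makes the two output sets independent given the inputs, so the probability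
    that both contain [i] factors into the two membership probabilities. *)
Lemma membership_protocol_success (R : realType) (U V : finType)
    (rho : U * V -> R) n (P : col_protocol R U V n) (i : 'I_n) :
  agr_success rho (membership_protocol P i) =
  \sum_u \sum_v \sum_S \sum_(T | i \in S :&: T) @col_joint _ _ _ rho n P u v S T.
Proof.
apply: eq_bigr => u _; apply: eq_bigr => v _ /=.
rewrite /membership_prob mulr_suml mulr_sumr [LHS]big_mkcond /=.
apply: eq_bigr => S _; case: ifPn => iS.
  rewrite !mulr_sumr; apply: eq_big => [T|T _]; first by rewrite inE iS.
  by rewrite mulrA.
by rewrite big_pred0 // => T; rewrite inE (negbTE iS).
Qed.

Lemma card_le_output_size (R : realType) (U V : finType) (rho : U * V -> R)
    n (P : col_protocol R U V n) u v S T :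
  0 < @col_joint _ _ _ rho n P u v S T ->
  (maxn #|S| #|T| <= output_size rho P)%N.
Proof.
move=> J0; apply: (bigop.bigmax_sup u) => //; apply: (bigop.bigmax_sup v) => //.
by apply: (bigop.bigmax_sup S) => //; apply: (bigop.bigmax_sup T).
Qed.

Lemma sum_membership_cost (R : realType) (U V : finType) (rho : U * V -> R)
    n (P : col_protocol R U V n) :
  is_distribution rho ->
  \sum_i agr_cost rho (membership_protocol P i) <= 2 * (output_size rho P)%:R.
Proof.
move=> rhoD; rewrite /agr_cost /= exchange_big /=.
rewrite -[leRHS]mul1r -[X in _ <= X * _](sum_tensor (col_len P) rhoD) mulr_suml.
apply: ler_sum => u _; rewrite exchange_big mulr_suml; apply: ler_sum => v _ /=.
rewrite -mulr_sumr big_split /= !sum_membership_prob.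
set A := @col_A _ _ _ _ P u; set B := @col_B _ _ _ _ P v; set t := tensor rho u v.
have [A0 A1] : is_distribution A := col_A_dist u.
have [B0 B1] : is_distribution B := col_B_dist v.
have t0 : 0 <= t by rewrite tensor_ge0 //; exact: rhoD.1.
(* Both sides are expanded over pairs of outcomes with their joint weight, since [output_size]
   controls cardinalities only on outcomes of positive joint probability. *)
have -> : t * (\sum_S A S * #|S|%:R + \sum_T B T * #|T|%:R) =
    \sum_S \sum_T t * A S * B T * (#|S|%:R + #|T|%:R).
  transitivity (\sum_S \sum_T (t * (A S * #|S|%:R * B T) + t * (A S * (B T * #|T|%:R)))).
    under [RHS]eq_bigr do rewrite big_split /= -!mulr_sumr B1 mulr1.
    by rewrite big_split /= -mulr_sumr -mulr_sumr -mulr_suml A1 mul1r mulrDr.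
  by apply: eq_bigr => S _; apply: eq_bigr => T _; ring.
have -> : t * (2 * (output_size rho P)%:R) =
    \sum_S \sum_T t * A S * B T * (2 * (output_size rho P)%:R).
  under [RHS]eq_bigr do rewrite -mulr_suml -mulr_sumr B1 mulr1.
  by rewrite -mulr_suml -mulr_sumr A1 mulr1.
apply: ler_sum => S _; apply: ler_sum => T _.
have : 0 <= t * A S * B T by rewrite !mulr_ge0.
rewrite le_eqVlt => /predU1P[<-|J0]; first by rewrite !mul0r.
rewrite ler_pM2l // -natrD -natrM ler_nat mul2n -addnn.
have := card_le_output_size J0; rewrite geq_max => /andP[? ?]; exact: leq_add.
Qed.

Theorem lemmaA4 (R : realType) (U V : finType) (rho : U * V -> R)
    (p q q' : \bar R) (c : R)
    (rho_dist : is_distribution rho) (rho_nondeg : ~ degenerate rho)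
    (p_ge1 : (1 <= p)%E) (p_le_q : (p <= q)%E)
    (q'E : (q^-1 + q'^-1 = 1)%E) (cE : (c%:E^-1 = p^-1 + q'^-1)%E)
    (rho_hyp : hypercontractive rho q p) :
  (forall z : R, 0 <= z <= 1 ->
     (((self_root p * self_root q' * z) `^ c / c)%:E <= agreement_complexity rho z)%E) /\
  (exists2 K : R, 0 < K &
     \forall n \near \oo,
       ((K * n%:R `^ (1 - c))%:E <= collision_complexity rho n)%E).
Proof.
(* Both conclusions rest on this bound for a single protocol: the first takes the infimum, the
   second sums it over the [n] membership protocols. *)
have bound z P : 0 <= z <= agr_success rho P ->
    (self_root p * self_root q' * z) `^ c / c <= agr_cost rho P.
  by move=> zP; exact: agreement_lower_bound q'E cE rho_hyp zP.
split=> [z /andP[z0 _]|].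
  by apply/ereal_infP => _ [P zP <-]; rewrite lee_fin bound // z0.
have [c0 s0] := exponent_facts p_ge1 p_le_q q'E cE.
set s := self_root p * self_root q' in bound s0.
(* Summing the agreement bound at [z = 1/n] over [n] indices gives [s]^ c / c * n [^ (1 - c)]; the
   factor 2 comes from [sum_membership_cost]. *)
exists (s `^ c / c / 2); first by rewrite !divr_gt0 ?powR_gt0.
near=> n; have n0 : (0 < n)%N by near: n; exact: nbhs_infty_gt.
have nR0 : 0 < n%:R :> R by rewrite ltr0n.
apply/ereal_infP => _ [P colP <-]; rewrite lee_fin.
rewrite mulrAC ler_pdivrMr // [leRHS]mulrC.
apply: le_trans (sum_membership_cost P rho_dist).
have -> : s `^ c / c * n%:R `^ (1 - c) = \sum_(i < n) (s * n%:R^-1) `^ c / c.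
  rewrite sumr_const card_ord -[RHS]mulr_natr powRM ?invr_ge0 ?(ltW s0) ?(ltW nR0) //.
  rewrite powRD ?(gt_eqF nR0) ?implybT // powRr1 ?(ltW nR0) //.
  by rewrite -(@powR_inv1 _ n%:R) ?(ltW nR0) // -powRrM mulN1r; ring.
apply: ler_sum => i _; apply: bound.
by rewrite invr_ge0 (ltW nR0) membership_protocol_success; exact: colP.
Unshelve. all: by end_near.
Qed.
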